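(* Let $(X,d)$ be a CAT$(0)$ space and let $T_1,T_2:X\to X$ satisfy property $(P_2)$. Suppose $\mathrm{Fix}(T_2\circ T_1)\neq\emptyset$. Let $(\varepsilon_n)$ and $(\delta_n)$ be sequences of nonnegative reals with $\sum_{n=0}^\infty\varepsilon_n<\infty$ and $\sum_{n=0}^\infty\delta_n<\infty$. Given any $x_0\in X$, let $(x_n)$ (starting at $x_0$) and $(y_n)$ be any sequences in $X$ satisfying $$d(y_n,T_1x_n)\le\varepsilon_n\quad\text{and}\quad d(x_{n+1},T_2y_n)\le\delta_n\quad\text{for each }n\in\mathbb{N}.$$ Then $(x_n)$ and $(y_n)$ are asymptotically regular, i.e. $\lim_{n\to\infty}d(x_n,x_{n+1})=0$ and $\lim_{n\to\infty}d(y_n,y_{n+1})=0$.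
   Context: $\mathbb{N}=\{0,1,2,\ldots\}$. $\mathrm{Fix}(T)$ is the set of fixed points of $T$. A mapping $T:C\to X$, with $C$ a nonempty subset of a metric space $(X,d)$, satisfies property $(P_2)$ iff $2d(Tx,Ty)^2\le d(x,Ty)^2+d(y,Tx)^2-d(x,Tx)^2-d(y,Ty)^2$ for all $x,y\in C$. A CAT$(0)$ space is a geodesic space of nonpositive curvature in the sense of Alexandrov; equivalently, a geodesic space such that for all $x,y,z$, all $t\in[0,1]$ and every point $m$ on a geodesic segment from $x$ to $y$ with $d(m,x)=t\,d(x,y)$, one has $d(z,m)^2\le(1-t)d(z,x)^2+t\,d(z,y)^2-t(1-t)d(x,y)^2$. *)

(* Defs.v *)
From HB Require Import structures.
From mathcomp Require Import all_boot all_order all_algebra.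
From mathcomp Require Import all_classical all_reals all_analysis.

Set Implicit Arguments.
Unset Strict Implicit.
Unset Printing Implicit Defensive.

Import Order.TTheory GRing.Theory Num.Theory.
Import numFieldNormedType.Exports.

Local Open Scope classical_set_scope.
Local Open Scope ring_scope.

(* A geodesic from x to y is an isometric embedding c : [0, d(x,y)] -> X;
   c is a total function whose values outside [0, d(x,y)] are irrelevant. *)
Definition is_geodesic (R : realType) (X : metricType R) (x y : X)
    (c : R -> X) : Prop :=
  [/\ c 0 = x, c (mdist x y) = y &
      forall s t : R, 0 <= s <= mdist x y -> 0 <= t <= mdist x y ->
        mdist (c s) (c t) = `|s - t|].

Definition geodesic_segment (R : realType) (X : metricType R) (x y : X)
    (c : R -> X) : set X :=
  c @` [set s : R | 0 <= s <= mdist x y].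

Definition geodesic_space (R : realType) (X : metricType R) : Prop :=
  forall x y : X, exists c : R -> X, is_geodesic x y c.

Definition CAT0 (R : realType) (X : metricType R) : Prop :=
  geodesic_space X /\
  forall (x y z : X) (t : R) (c : R -> X) (m : X),
    0 <= t <= 1 -> is_geodesic x y c -> geodesic_segment x y c m ->
    mdist m x = t * mdist x y ->
    mdist z m ^+ 2 <= (1 - t) * mdist z x ^+ 2 + t * mdist z y ^+ 2
                      - t * (1 - t) * mdist x y ^+ 2.

(* A mapping C -> X is a total function of which only the values on C matter. *)
Definition property_P2 (R : realType) (X : metricType R) (C : set X)
    (T : X -> X) : Prop :=
  forall x y : X, C x -> C y ->
    2 * mdist (T x) (T y) ^+ 2 <=
      mdist x (T y) ^+ 2 + mdist y (T x) ^+ 2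
      - mdist x (T x) ^+ 2 - mdist y (T y) ^+ 2.

Definition Fix (X : Type) (T : X -> X) : set X := [set x | T x = x].

Definition asymptotically_regular (R : realType) (X : metricType R)
    (x : nat -> X) : Prop :=
  mdist (x n) (x n.+1) @[n --> \oo] --> (0 : R).

(* Main.v *)
Require Import Defs.
From HB Require Import structures.
From mathcomp Require Import all_boot all_order all_algebra.
From mathcomp Require Import all_classical all_reals all_analysis.
From mathcomp Require Import ring lra.

(* Let p be a fixed point of T2 T1 and q = T1 p.  By the four-point inequality
   of CAT(0) spaces a map with (P2) is nonexpansive, so up to summable errors
   d(x_n, p) and d(x_n, x_(n+k)) decrease; their limits rho and a_k are also
   those of d(y_n, q) and d(y_n, y_(n+k)).  Hence (P2) and the four-point
   inequality, applied to x_n, x_(n+k) and their images y_n, y_(n+k), pinch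
   d(x_n, y_(n+k))^2 + d(x_(n+k), y_n)^2 - d(x_n, y_n)^2 - d(x_(n+k), y_(n+k))^2
   to 2 a_k^2, and likewise for T2.  In Cesaro means, where shifts are
   invisible, these identities force a_k = k a_1; as the orbits are bounded,
   a_1 = 0. *)

Import Order.TTheory GRing.Theory Num.Theory.
Import numFieldNormedType.Exports.

Local Open Scope classical_set_scope.
Local Open Scope ring_scope.

(** * CAT(0) geometry and nonexpansiveness *)

(** Squaring [s - e <= d] requires [e <= s]; otherwise the left side is [s (s - 2 e) <= 0]. *)
Lemma sqr_ge_subM (R : realDomainType) (s d e : R) :
  0 <= s -> 0 <= d -> 0 <= e -> s <= d + e -> s ^+ 2 - 2 * e * s <= d ^+ 2.
Proof.
move=> s0 d0 e0 sde; have [es|se] := leP e s; last by nra.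
have : (s - e) ^+ 2 <= d ^+ 2 by rewrite lerXn2r ?nnegrE; lra.
nra.
Qed.

Lemma sqrD_le_weighted (R : realFieldType) (t u v : R) : 0 < t < 1 ->
  (u + v) ^+ 2 <= u ^+ 2 / t + v ^+ 2 / (1 - t).
Proof.
move=> /andP[t0 t1]; have s0 : 0 < 1 - t by lra.
rewrite -subr_ge0.
have -> : u ^+ 2 / t + v ^+ 2 / (1 - t) - (u + v) ^+ 2 =
    ((1 - t) * u - t * v) ^+ 2 / (t * (1 - t)).
  by field; rewrite !gt_eqF.
by rewrite divr_ge0 ?sqr_ge0// mulr_ge0// ltW.
Qed.

(* The Berg-Nikolaev four-point inequality.  Compare [a] and [c] with the point
   dividing the diagonal [b, d] in the ratio of the two sides [a b], [c d]. *)
Lemma CAT0_quadrilateral (R : realType) (X : metricType R) (a b c d : X) :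
  CAT0 X ->
  mdist a c ^+ 2 + mdist b d ^+ 2 - mdist b c ^+ 2 - mdist a d ^+ 2
    <= 2 * mdist a b * mdist c d.
Proof.
move=> [geoX catX].
have [<-|ab] := eqVneq a b; first by rewrite mdistxx; lra.
have [<-|cd] := eqVneq c d; first by rewrite mdistxx; lra.
have A0 : 0 < mdist a b by rewrite mdist_gt0.
have C0 : 0 < mdist c d by rewrite mdist_gt0.
set A := mdist a b in A0 *; set C := mdist c d in C0 *.
have AC0 : 0 < A + C by lra.
pose t := A / (A + C).
have t0 : 0 < t by rewrite divr_gt0.
have t1 : t < 1 by rewrite ltr_pdivrMr// mul1r; lra.
have [g geo_g] := geoX b d; have [g0 gd giso] := geo_g.
set D := mdist b d in gd giso *.
have D0 : 0 <= D by exact: mdist_ge0.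
have tD : 0 <= t * D <= D by apply/andP; split; nra.
pose m := g (t * D).
have mb : mdist m b = t * D.
  rewrite -g0 giso// ?lexx ?D0// subr0 ger0_norm//; by case/andP: tD.
have mseg : geodesic_segment b d g m by exists (t * D).
have t01 : 0 <= t <= 1 by rewrite !ltW.
have am := catX b d a t g m t01 geo_g mseg mb.
have cm := catX b d c t g m t01 geo_g mseg mb.
have acm := metric_triangle a m c.
rewrite -/D (metric_sym c b) -/A -/C in am cm; rewrite (metric_sym m c) in acm.
have s0 : 0 < 1 - t by lra.
have := @sqrD_le_weighted R t (mdist a m) (mdist c m).
rewrite t0 t1 => /(_ isT) sq.
have ac2 : mdist a c ^+ 2 <= (mdist a m + mdist c m) ^+ 2.
  by rewrite lerXn2r// nnegrE ?addr_ge0// mdist_ge0.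
(* The choice of [t] gives [(1 - t) / t = C / A], so both side terms become [A C], and the
   coefficients [1 - t] and [t] of [D ^+ 2] add up to 1. *)
have am' : mdist a m ^+ 2 / t <=
    C * A + mdist a d ^+ 2 - (1 - t) * D ^+ 2.
  rewrite ler_pdivrMr//; apply: (le_trans am).
  have -> : (1 - t) * A ^+ 2 = C * A * t by rewrite /t; field; rewrite gt_eqF.
  by lra.
have cm' : mdist c m ^+ 2 / (1 - t) <=
    mdist b c ^+ 2 + A * C - t * D ^+ 2.
  rewrite ler_pdivrMr//; apply: (le_trans cm).
  have -> : t * C ^+ 2 = A * C * (1 - t) by rewrite /t; field; rewrite gt_eqF.
  by lra.
by lra.
Qed.

(** The right side of (P2) is the left side of the four-point inequality for [u], [v], [T v], [T u];
    hence d(Tu,Tv)^2 <= d(u,v) d(Tu,Tv). *)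
Lemma P2_nonexpansive (R : realType) (X : metricType R) (T : X -> X) :
  CAT0 X -> property_P2 setT T ->
  forall u v, mdist (T u) (T v) <= mdist u v.
Proof.
move=> cX PT u v; have := PT u v I I.
have := CAT0_quadrilateral _ _ u v (T v) (T u) cX.
rewrite (metric_sym (T v) (T u)).
have := mdist_ge0 u v; have := mdist_ge0 (T u) (T v).
set a := mdist (T u) (T v); set b := mdist u v => a0 b0 q p.
have : a * a <= b * a by nra.
have [->//|a1] := eqVneq a 0.
by rewrite ler_pM2r// lt_def a1.
Qed.

(** * Sequences monotone up to summable errors *)

Lemma series_shift_cvgn (R : realType) (e : nat -> R) k :
  cvgn (series e) -> cvgn (series (fun n => e (n + k)%N)).
Proof.
move=> ce.
have -> : series (fun n => e (n + k)%N) =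
    (fun n => series e (n + k)%N - series e k).
  apply/funext => n; rewrite sub_series_geq ?leq_addl//.
  by rewrite -{2}(add0n k) big_addn addnK.
apply: is_cvgB; last exact: is_cvg_cst.
by have /cvg_ex[l el] := ce; apply/cvg_ex; exists l; rewrite (cvg_shiftn k (series e)).
Qed.

(** Subtracting the partial sums of [e] from [v] leaves a nonincreasing sequence, bounded below
    because these sums are bounded. *)
Lemma quasi_monotone_cvgn (R : realType) (v e : nat -> R) :
  (forall n, 0 <= v n) -> (forall n, v n.+1 <= v n + e n) ->
  cvgn (series e) -> cvgn v.
Proof.
move=> v0 ve ce; pose w n := v n - series e n.
have cw : cvgn w.
  apply: nonincreasing_is_cvgn.
    apply/nonincreasing_seqP => n; rewrite /w.
    have := seriesSB e n; have := ve n; lra.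
  have [M [_ eM]] := cvg_seq_bounded ce.
  exists (- (M + 1)) => _ [n _ <-]; rewrite /w.
  have /= := eM (M + 1) ltac:(lra) n I.
  have := v0 n; have := ler_norm (series e n); lra.
have -> : v = w + series e by apply/funext => n; rewrite /w /= !fctE; lra.
exact: is_cvgD.
Qed.

(** * Cesaro means *)

Lemma arithmetic_mean_cvgD (R : realType) (f g : nat -> R) (l l' : R) :
  arithmetic_mean f @ \oo --> l -> arithmetic_mean g @ \oo --> l' ->
  arithmetic_mean (fun n => f n + g n) @ \oo --> l + l'.
Proof.
move=> fl gl.
have -> : arithmetic_mean (fun n => f n + g n) =
    arithmetic_mean f + arithmetic_mean g.
  by apply/funext => n; rewrite /arithmetic_mean !fctE/= (seriesD f g) mulrDr.
exact: cvgD.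
Qed.

Lemma arithmetic_mean_cvgN (R : realType) (f : nat -> R) (l : R) :
  arithmetic_mean f @ \oo --> l ->
  arithmetic_mean (fun n => - f n) @ \oo --> - l.
Proof.
move=> fl.
have -> : arithmetic_mean (fun n => - f n) = - arithmetic_mean f.
  by apply/funext => n; rewrite /arithmetic_mean !fctE/= (seriesN f) mulrN.
exact: cvgN.
Qed.

Lemma arithmetic_mean_cvg_ext (R : realType) (f g : nat -> R) (l l' : R) :
  (forall n, f n = g n) -> l = l' ->
  arithmetic_mean f @ \oo --> l -> arithmetic_mean g @ \oo --> l'.
Proof. by move=> /funext -> ->. Qed.

(** Each unit shift telescopes to two bounded boundary terms, which the factor [harmonic n] sends to
    0. *)
Lemma arithmetic_mean_cvg_shift (R : realType) (f : nat -> R) k :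
  bounded_fun f ->
  arithmetic_mean (fun n => f (n + k)%N - f n) @ \oo --> (0 : R).
Proof.
move=> [M [_ fM]]; pose B := M + 1.
have fB n : `|f n| <= B by apply: (fM B _ n I); rewrite /B; lra.
elim: k => [|k IHk].
  apply: (@arithmetic_mean_cvg_ext _ (fun=> 0) _ 0) => // [n|].
    by rewrite addn0 subrr.
  by apply: cesaro; exact: cvg_cst.
have step : arithmetic_mean (fun n => f (n + k).+1 - f (n + k)%N) @ \oo --> (0 : R).
  have -> : arithmetic_mean (fun n => f (n + k).+1 - f (n + k)%N) =
      (fun n => harmonic n * (f (n + k).+1 - f k)).
    apply/funext => n; rewrite /arithmetic_mean/= /series/=.
    by rewrite (telescope_sumr (fun n => f (n + k)%N))// add0n addSn.
  apply: norm_cvg0.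
  apply: (@squeeze_cvgr _ _ _ _ (fun=> 0) (fun n => harmonic n * (2 * B))).
  - apply: nearW => n; rewrite normr_ge0/= normrM ger0_norm ?harmonic_ge0//.
    rewrite ler_wpM2l ?harmonic_ge0// (le_trans (ler_normB _ _))//.
    have := fB (n + k).+1; have := fB k; lra.
  - exact: cvg_cst.
  - rewrite -[X in _ --> X](mul0r (2 * B)); by apply: cvgM; [exact: cvg_harmonic|exact: cvg_cst].
apply: arithmetic_mean_cvg_ext (arithmetic_mean_cvgD _ _ _ _ _ step IHk) => [n|].
  by rewrite addnS; lra.
by rewrite addr0.
Qed.

(** This allows a pointwise bound on a sequence [f] of which only the means are known to
    converge. *)
Lemma arithmetic_mean_cvg_le (R : realType) (f g : nat -> R) (l l' : R) :
  (forall n, f n <= g n) ->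
  arithmetic_mean f @ \oo --> l -> g @ \oo --> l' -> l <= l'.
Proof.
move=> fg fl /cesaro gl; apply: ler_cvg_to fl gl _; apply: nearW => n.
rewrite /arithmetic_mean/= ler_wpM2l ?invr_ge0//.
by rewrite /series/=; apply: ler_sum.
Qed.

(* Read [alpha k n] as d(x_n, y_(n+k))^2, [beta k n] as d(y_n, x_(n+k))^2 and
   [a k] as the limit of d(x_n, x_(n+k)).  Writing m for the mean, one has
   m(alpha k - alpha 0) = m(beta k.+1 - alpha 0) = k (k + 1) (a 1)^2; inserting
   this in the last hypothesis propagates a k = k (a 1) from k.+1 to k.+2. *)
Lemma mean_second_difference_linear (R : realType) (alpha beta : nat -> nat -> R)
    (a : nat -> R) :
  (forall k, bounded_fun (alpha k)) -> (forall k, bounded_fun (beta k)) ->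
  (forall k, 0 <= a k) -> (forall k, a k.+1 <= a k + a 1%N) ->
  (forall k, (alpha k n + beta k n - alpha 0%N n - alpha 0%N (n + k)%N)
    @[n --> \oo] --> 2 * a k ^+ 2) ->
  (forall k, (beta k.+2 n + alpha k n.+1 - beta 1%N n - beta 1%N (n + k.+1)%N)
    @[n --> \oo] --> 2 * a k.+1 ^+ 2) ->
  arithmetic_mean (fun n => beta 1%N n - alpha 0%N n) @ \oo --> (0 : R) ->
  (forall k, exists2 g : nat -> R, g @ \oo --> 2 * a 1%N * a k.+2 &
    forall n, alpha k.+1 n.+1 + beta 2%N n - alpha k n.+2 - beta 1%N n <= g n) ->
  forall k, a k.+1 = k.+1%:R * a 1%N.
Proof.
move=> balpha bbeta a0 asub hA hB hC hQ.
have sa k j := arithmetic_mean_cvg_shift _ _ j (balpha k).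
have sb k j := arithmetic_mean_cvg_shift _ _ j (bbeta k).
pose D := arithmetic_mean_cvgD; pose N := arithmetic_mean_cvgN.
have mA k := cesaro (hA k).
have mB k := cesaro (hB k).
have b2 : arithmetic_mean (fun n => beta 2%N n - beta 1%N n) @ \oo -->
    2 * a 1%N ^+ 2.
  apply: arithmetic_mean_cvg_ext (D _ _ _ _ _ (D _ _ _ _ _ (mB 0%N) hC)
    (D _ _ _ _ _ (sb 1%N 1%N) (N _ _ _ (sa 0%N 1%N)))) => [n|].
    by rewrite !addn1; lra.
  by lra.
suff H k : [/\ arithmetic_mean (fun n => alpha k n - alpha 0%N n) @ \oo -->
      k%:R * k.+1%:R * a 1%N ^+ 2,
    arithmetic_mean (fun n => beta k.+1 n - alpha 0%N n) @ \oo -->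
      k%:R * k.+1%:R * a 1%N ^+ 2 & a k.+1 = k.+1%:R * a 1%N].
  by move=> k; have [] := H k.
elim: k => [|k [Ha Hb Hk]].
  rewrite !mul0r mul1r; split=> //.
  apply: (@arithmetic_mean_cvg_ext _ (fun=> 0) _ 0) => // [n|].
    by rewrite subrr.
  by apply: cesaro; exact: cvg_cst.
(* Up to a shift, [hA] minus [Hb]: 2 (k+1)^2 - k (k+1) = (k+1)(k+2). *)
have Ha' : arithmetic_mean (fun n => alpha k.+1 n - alpha 0%N n) @ \oo -->
      k.+1%:R * k.+2%:R * a 1%N ^+ 2.
  apply: arithmetic_mean_cvg_ext (D _ _ _ _ _ (D _ _ _ _ _ (mA k.+1) (N _ _ _ Hb))
    (sa 0%N k.+1)) => [n|]; first by lra.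
  by rewrite Hk -!natr1; ring.
(* Up to shifts, [hB] minus [Ha]; [hC] enters twice, to trade both [beta 1] terms for [alpha 0]. *)
have Hb' : arithmetic_mean (fun n => beta k.+2 n - alpha 0%N n) @ \oo -->
      k.+1%:R * k.+2%:R * a 1%N ^+ 2.
  apply: arithmetic_mean_cvg_ext (D _ _ _ _ _ (D _ _ _ _ _ (D _ _ _ _ _ (mB k)
    (N _ _ _ (D _ _ _ _ _ Ha (sa k 1%N)))) (D _ _ _ _ _ hC hC))
    (sb 1%N k.+1)) => [n|]; first by rewrite !addn1; lra.
  by rewrite Hk -!natr1; ring.
split=> //; apply/eqP; rewrite eq_le; apply/andP; split.
  by apply: (le_trans (asub _)); rewrite Hk -!natr1; lra.
(* For the lower bound, the left side in [hQ] has mean 2 + (k+1)(k+2) - k (k+1) = 2 (k+2) times the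
   square of [a 1]; a nonzero factor [2 a 1] then cancels. *)
have [g gl fg] := hQ k.
have [a10|a1] := eqVneq (a 1%N) 0; first by rewrite a10 mulr0.
have a1_gt0 : 0 < a 1%N by rewrite lt_def a1 a0.
have E : arithmetic_mean (fun n => alpha k.+1 n.+1 + beta 2%N n - alpha k n.+2 -
    beta 1%N n) @ \oo --> 2 * a 1%N * (k.+2%:R * a 1%N).
  apply: arithmetic_mean_cvg_ext (D _ _ _ _ _ (D _ _ _ _ _ b2
      (D _ _ _ _ _ Ha' (sa k.+1 1%N)))
    (N _ _ _ (D _ _ _ _ _ Ha (sa k 2%N)))) => [n|].
    by rewrite !addn1 addn2; lra.
  by rewrite -!natr1; ring.
have := arithmetic_mean_cvg_le _ _ _ _ _ fg E gl.
by rewrite ler_pM2l// mulr_gt0.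
Qed.

(** * Asymptotic equality in (P2) *)

(** The four-point inequality bounds the expression above, (P2) bounds it below up to the errors of
    [s'] and [t'] as images of [s] and [t]. Both bounds tend to the same limit since the map
    asymptotically preserves the distance. *)
Lemma P2_quadrilateral_cvg (R : realType) (X : metricType R) (T : X -> X)
    (s t s' t' : nat -> X) (r B : R) :
  CAT0 X -> property_P2 setT T ->
  mdist (s' n) (T (s n)) @[n --> \oo] --> 0 ->
  mdist (t' n) (T (t n)) @[n --> \oo] --> 0 ->
  (forall n, mdist (s n) (t' n) <= B) -> (forall n, mdist (t n) (s' n) <= B) ->
  (forall n, mdist (s n) (s' n) <= B) -> (forall n, mdist (t n) (t' n) <= B) ->
  mdist (s n) (t n) @[n --> \oo] --> r ->
  mdist (s' n) (t' n) @[n --> \oo] --> r ->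
  (mdist (s n) (t' n) ^+ 2 + mdist (t n) (s' n) ^+ 2
    - mdist (s n) (s' n) ^+ 2 - mdist (t n) (t' n) ^+ 2)
  @[n --> \oo] --> 2 * r ^+ 2.
Proof.
move=> cX PT es et Bst Bts Bss Btt st st'.
pose e n := mdist (s' n) (T (s n)) + mdist (t' n) (T (t n)).
have e0 : e n @[n --> \oo] --> 0 by rewrite -(addr0 0); exact: cvgD.
apply: (@squeeze_cvgr _ _ _ _
  (* Moving the images costs [4 e d] on the left of (P2), with [d] the distance from [s'] to [t'].
     On its right, the four squares cost at most [4 B e] in linear terms, and the quadratic ones are
     absorbed in [e e]. *)
  (fun n => 2 * (mdist (s' n) (t' n) * mdist (s' n) (t' n))
     - 4 * (e n * mdist (s' n) (t' n)) - 4 * B * e n - e n * e n)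
  (fun n => 2 * (mdist (s n) (t n) * mdist (s' n) (t' n)))).
- apply: nearW => n.
  have := CAT0_quadrilateral _ _ (s n) (t n) (t' n) (s' n) cX.
  have := PT (s n) (t n) I I.
  have := @sqr_ge_subM _ _ _ (mdist (s' n) (T (s n)))
    (mdist_ge0 (s n) (s' n)) (mdist_ge0 (s n) (T (s n))) (mdist_ge0 _ _).
  have := @sqr_ge_subM _ _ _ (mdist (t' n) (T (t n)))
    (mdist_ge0 (t n) (t' n)) (mdist_ge0 (t n) (T (t n))) (mdist_ge0 _ _).
  have := @sqr_ge_subM _ _ _ (e n)
    (mdist_ge0 (s' n) (t' n)) (mdist_ge0 (T (s n)) (T (t n))).
  have := metric_triangle (s n) (T (s n)) (s' n).
  have := metric_triangle (t n) (T (t n)) (t' n).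
  have := metric_triangle (s n) (t' n) (T (t n)).
  have := metric_triangle (t n) (s' n) (T (s n)).
  have := metric_triangle (s' n) (T (s n)) (t' n).
  have := metric_triangle (T (s n)) (T (t n)) (t' n).
  rewrite (metric_sym (T (s n)) (s' n)) (metric_sym (T (t n)) (t' n)).
  rewrite (metric_sym (t' n) (s' n)).
  have := mdist_ge0 (s' n) (T (s n)); have := mdist_ge0 (t' n) (T (t n)).
  have := mdist_ge0 (s n) (t' n); have := mdist_ge0 (t n) (s' n).
  have := mdist_ge0 (s n) (T (t n)); have := mdist_ge0 (t n) (T (s n)).
  have := Bst n; have := Bts n; have := Bss n; have := Btt n.
  rewrite /e.
  move: (mdist (s' n) (T (s n))) (mdist (t' n) (T (t n))) (mdist (s n) (t' n))
    (mdist (t n) (s' n)) (mdist (s n) (T (t n))) (mdist (t n) (T (s n)))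
    (mdist (s' n) (t' n)) (mdist (s n) (s' n)) (mdist (t n) (t' n))
    (mdist (s n) (t n)) (mdist (s n) (T (s n))) (mdist (t n) (T (t n)))
    (mdist (T (s n)) (T (t n))) (mdist (s' n) (T (t n))).
  move=> e1 e2 st1 ts1 sTt tTs d ss tt d0 sTs tTt dT z.
  move=> htt hss hts hst tTs0 sTt0 ts0 st0 e20 e10 h1 h2 h3 h4 h5 h6.
  move=> /(_ ltac:(lra) ltac:(lra)) q1 /(_ h5) q2 /(_ h6) q3 p q.
  have u1 : sTt ^+ 2 <= st1 ^+ 2 + 2 * B * e2 + e2 ^+ 2.
    have : sTt ^+ 2 <= (st1 + e2) ^+ 2 by rewrite lerXn2r ?nnegrE; lra.
    nra.
  have u2 : tTs ^+ 2 <= ts1 ^+ 2 + 2 * B * e1 + e1 ^+ 2.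
    have : tTs ^+ 2 <= (ts1 + e1) ^+ 2 by rewrite lerXn2r ?nnegrE; lra.
    nra.
  have u3 : 2 * e1 * ss <= 2 * B * e1 by nra.
  have u4 : 2 * e2 * tt <= 2 * B * e2 by nra.
  have u5 : 0 <= e1 * e2 by rewrite mulr_ge0.
  by apply/andP; split; nra.
- have -> : 2 * r ^+ 2 = 2 * (r * r) - 4 * (0 * r) - 4 * B * 0 - 0 * 0 by ring.
  apply: cvgB; last exact: cvgM.
  apply: cvgB; last by apply: cvgM => //; exact: cvg_cst.
  by apply: cvgB; apply: cvgM; try exact: cvg_cst; exact: cvgM.
- have -> : 2 * r ^+ 2 = 2 * (r * r) by ring.
  by apply: cvgM; [exact: cvg_cst|exact: cvgM].
Qed.

(** * The inexact alternating iteration *)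

Theorem theorem3p6 (R : realType) (X : metricType R) (T1 T2 : X -> X)
    (eps delta : nat -> R) (x0 : X) (x y : nat -> X)
    (hX : CAT0 X)
    (hT1 : property_P2 setT T1) (hT2 : property_P2 setT T2)
    (hFix : Fix (T2 \o T1) !=set0)
    (eps_ge0 : forall n, 0 <= eps n) (delta_ge0 : forall n, 0 <= delta n)
    (eps_sum : (\sum_(0 <= n <oo) (eps n)%:E < +oo)%E)
    (delta_sum : (\sum_(0 <= n <oo) (delta n)%:E < +oo)%E)
    (hx0 : x 0%N = x0)
    (hy : forall n, mdist (y n) (T1 (x n)) <= eps n)
    (hx : forall n, mdist (x n.+1) (T2 (y n)) <= delta n) :
  asymptotically_regular x /\ asymptotically_regular y.
Proof.
have [p /= Tp] := hFix; pose q := T1 p.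
have Tq : T2 q = p by [].
have ne1 := P2_nonexpansive _ _ _ hX hT1; have ne2 := P2_nonexpansive _ _ _ hX hT2.
have ceps := nnseries_is_cvg eps_ge0 eps_sum.
have cdelta := nnseries_is_cvg delta_ge0 delta_sum.
have eps0 := cvg_series_cvg_0 ceps; have delta0 := cvg_series_cvg_0 cdelta.
have shiftn (f : nat -> R) (l : R) k : f @ \oo --> l -> f (n + k)%N @[n --> \oo] --> l.
  by move=> fl; have := cvg_shiftn k f (nbhs l); rewrite /= => ->.
have shiftS (f : nat -> R) (l : R) : f @ \oo --> l -> f n.+1 @[n --> \oo] --> l.
  by move=> fl; have := cvg_shiftS f (nbhs l); rewrite /= => ->.
have err1 : mdist (y n) (T1 (x n)) @[n --> \oo] --> 0.
  apply: (@squeeze_cvgr _ _ _ _ (fun=> 0) eps); [|exact: cvg_cst|exact: eps0].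
  by apply: nearW => n; rewrite mdist_ge0 hy.
have err2 : mdist (x n.+1) (T2 (y n)) @[n --> \oo] --> 0.
  apply: (@squeeze_cvgr _ _ _ _ (fun=> 0) delta); [|exact: cvg_cst|exact: delta0].
  by apply: nearW => n; rewrite mdist_ge0 hx.
have ystep n u : mdist (y n) (T1 u) <= mdist (x n) u + eps n.
  have := metric_triangle (y n) (T1 (x n)) (T1 u); have := hy n.
  have := ne1 (x n) u; lra.
have xstep n u : mdist (x n.+1) (T2 u) <= mdist (y n) u + delta n.
  have := metric_triangle (x n.+1) (T2 (y n)) (T2 u); have := hx n.
  have := ne2 (y n) u; lra.
have yystep n m : mdist (y n) (y m) <= mdist (x n) (x m) + eps n + eps m.
  have := metric_triangle (y n) (T1 (x m)) (y m); have := hy m.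
  rewrite (metric_sym (y m)); have := ystep n (x m); lra.
have xxstep n m : mdist (x n.+1) (x m.+1) <= mdist (y n) (y m) + delta n + delta m.
  have := metric_triangle (x n.+1) (T2 (y m)) (x m.+1); have := hx m.
  rewrite (metric_sym (x m.+1)); have := xstep n (y m); lra.
pose gamma n := eps n + delta n.
have cgamma : cvgn (series gamma) by exact: (is_cvg_seriesD ceps cdelta).
have /cvg_ex[rho xp] : cvgn (fun n => mdist (x n) p).
  apply: quasi_monotone_cvgn cgamma => n; first exact: mdist_ge0.
  have := xstep n q; have := ystep n p; rewrite Tq -/q /gamma; lra.
have yq : mdist (y n) q @[n --> \oo] --> (rho : R).
  apply: (@squeeze_cvgr _ _ _ _ (fun n => mdist (x n.+1) p - delta n)
    (fun n => mdist (x n) p + eps n)).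
  - apply: nearW => n; have := xstep n q; have := ystep n p.
    rewrite Tq -/q => h1 h2; apply/andP; split; lra.
  - rewrite -[X in _ --> X](subr0 rho); apply: cvgB => //.
    exact: (shiftS _ _ xp).
  - by rewrite -[X in _ --> X](addr0 rho); apply: cvgD.
have bnd (f : nat -> R) (l : R) : f @ \oo --> l -> exists B, forall n, f n <= B.
  move=> fl; have /cvg_seq_bounded[M [_ fM]] : cvgn f by apply/cvg_ex; exists l.
  exists (M + 1) => n; apply: (le_trans (ler_norm _)).
  by apply: (fM (M + 1) _ n I); lra.
have [Bx hBx] := bnd _ _ xp; have [By hBy] := bnd _ _ yq.
(* One bound for all distances among the [x n], [p], [q] and from these to the [y n]: [2 Bx] serves
   two points of [x] joined through [p], the rest paths through both [p] and [q]. *)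
pose M := 2 * Bx + By + mdist p q.
have Bx0 : 0 <= Bx by apply: le_trans (hBx 0%N); exact: mdist_ge0.
have By0 : 0 <= By by apply: le_trans (hBy 0%N); exact: mdist_ge0.
have pq0 := mdist_ge0 p q.
have Mxq n : mdist (x n) q <= M.
  have := metric_triangle (x n) p q; have := hBx n; rewrite /M; lra.
have Mpy n : mdist p (y n) <= M.
  have := metric_triangle p q (y n); have := hBy n.
  rewrite (metric_sym (y n)) /M; lra.
have Mxy n m : mdist (x n) (y m) <= M.
  have := metric_triangle (x n) q (y m); have := hBy m.
  have := metric_triangle (x n) p q; have := hBx n.
  rewrite (metric_sym (y m)) /M; lra.
have Mxx n m : mdist (x n) (x m) <= M.
  have := metric_triangle (x n) p (x m); have := hBx n; have := hBx m.
  rewrite (metric_sym (x m)) /M; lra.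
have Mpq : mdist p q <= M by rewrite /M; lra.
pose a k := limn (fun n => mdist (x n) (x (n + k)%N)).
have xa k : mdist (x n) (x (n + k)%N) @[n --> \oo] --> a k.
  have cg : cvgn (series (gamma + fun n => gamma (n + k)%N)).
    by apply: is_cvg_seriesD => //; exact: series_shift_cvgn.
  apply: quasi_monotone_cvgn cg => n; first exact: mdist_ge0.
  have := xxstep n (n + k)%N; have := yystep n (n + k)%N.
  rewrite addSn !fctE /gamma; lra.
have ya k : mdist (y n) (y (n + k)%N) @[n --> \oo] --> a k.
  apply: (@squeeze_cvgr _ _ _ _
    (fun n => mdist (x n.+1) (x (n.+1 + k)%N) - (delta n + delta (n + k)%N))
    (fun n => mdist (x n) (x (n + k)%N) + (eps n + eps (n + k)%N))).
  - apply: nearW => n; have := xxstep n (n + k)%N; have := yystep n (n + k)%N.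
    rewrite addSn => h1 h2; apply/andP; split; lra.
  - rewrite -[X in _ --> X](subr0 (a k)); apply: cvgB => //.
      exact: (shiftS _ _ (xa k)).
    by rewrite -(addr0 0); apply: cvgD => //; exact: shiftn.
  - rewrite -[X in _ --> X](addr0 (a k)); apply: cvgD => //.
    by rewrite -(addr0 0); apply: cvgD => //; exact: shiftn.
have a_ge0 k : 0 <= a k.
  apply: ler_cvg_to (cvg_cst 0) (xa k) _.
  by apply: nearW => n; exact: mdist_ge0.
have a_leM k : a k <= M.
  by apply: ler_cvg_to (xa k) (cvg_cst M) _; apply: nearW => n.
have a_sub k : a k.+1 <= a k + a 1%N.
  apply: ler_cvg_to (xa k.+1) (cvgD (xa k) (shiftn _ _ k (xa 1%N))) _.
  by apply: nearW => n; rewrite !fctE addn1 addnS; exact: metric_triangle.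
pose alpha k n := mdist (x n) (y (n + k)%N) ^+ 2.
pose beta k n := mdist (y n) (x (n + k)%N) ^+ 2.
have sqr_bounded (f : nat -> R) : (forall n, 0 <= f n <= M) ->
    bounded_fun (fun n => f n ^+ 2).
  move=> fM; exists (M ^+ 2); split; first exact: num_real.
  move=> B MB n _ /=; apply: le_trans (ltW MB).
  have /andP[f0 fMn] := fM n.
  by rewrite ger0_norm ?sqr_ge0// lerXn2r ?nnegrE// (le_trans f0).
have balpha k : bounded_fun (alpha k).
  by apply: sqr_bounded => n; rewrite mdist_ge0 Mxy.
have bbeta k : bounded_fun (beta k).
  by apply: sqr_bounded => n; rewrite mdist_ge0 metric_sym Mxy.
have x1 : mdist (x n) (x n.+1) @[n --> \oo] --> a 1%N.
  by have := xa 1%N; under eq_fun do rewrite addn1.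
have a_linear : forall k, a k.+1 = k.+1%:R * a 1%N.
  apply: (mean_second_difference_linear _ alpha beta) => // [k|k||k].
  - have err1k := shiftn _ _ k err1.
    have := P2_quadrilateral_cvg _ _ _ _ _ _ _ _ M hX hT1 err1 err1k
      (fun n => Mxy n (n + k)%N) (fun n => Mxy (n + k)%N n)
      (fun n => Mxy n n) (fun n => Mxy (n + k)%N (n + k)%N) (xa k) (ya k).
    apply: cvg_trans; apply: near_eq_cvg; apply: nearW => n.
    by rewrite /alpha /beta !addn0 (metric_sym (y n)).
  (* [T2] sends [y n] near [x n.+1], so the offset [k.+1] pairs [y (n + k.+1)] with [x n.+1], which
     is [alpha k n.+1]. *)
  - have err2k := shiftn _ _ k.+1 err2.
    have Myx n m : mdist (y n) (x m) <= M by rewrite metric_sym.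
    have xak := shiftS _ _ (xa k.+1).
    have := P2_quadrilateral_cvg _ _ _ _ _ _ _ _ M hX hT2 err2 err2k
      (fun n => Myx n _) (fun n => Myx _ n.+1)
      (fun n => Myx n _) (fun n => Myx _ _) (ya k.+1) xak.
    apply: cvg_trans; apply: near_eq_cvg; apply: nearW => n.
    by rewrite /alpha /beta !addn1 !addnS addSn (metric_sym (x n.+1)).
  (* The pairs (x_n, p) under [T1] and (y_n, q) under [T2] give the same limit [2 rho ^+ 2]. In the
     difference only [beta 1 - alpha 0] and a unit shift of d(x_n, q)^2 remain, and the latter has
     mean 0. *)
  - have bphi : bounded_fun (fun n => mdist (x n) q ^+ 2).
      by apply: sqr_bounded => n; rewrite mdist_ge0 Mxq.
    have e1 : mdist q (T1 p) @[n --> \oo] --> 0 by rewrite mdistxx; exact: cvg_cst.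
    have e2 : mdist p (T2 q) @[n --> \oo] --> 0.
      by rewrite Tq mdistxx; exact: cvg_cst.
    have c1 := P2_quadrilateral_cvg _ _ _ _ _ _ _ _ M hX hT1 err1 e1
      (fun n => Mxq n) (fun n => Mpy n) (fun n => Mxy n n) (fun=> Mpq) xp yq.
    have xp1 := shiftS _ _ xp.
    have c2 : (mdist p (y n) ^+ 2 + mdist (x n.+1) q ^+ 2 -
        mdist (x n.+1) (y n) ^+ 2 - mdist p q ^+ 2) @[n --> \oo] --> 2 * rho ^+ 2.
      have Myp n : mdist (y n) p <= M by rewrite metric_sym.
      have Mqx n : mdist q (x n.+1) <= M by rewrite metric_sym.
      have Mqp : mdist q p <= M by rewrite metric_sym.
      have Myx n : mdist (y n) (x n.+1) <= M by rewrite metric_sym.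
      have := P2_quadrilateral_cvg _ _ _ _ _ _ _ _ M hX hT2 err2 e2
        Myp Mqx Myx (fun=> Mqp) yq xp1.
      apply: cvg_trans; apply: near_eq_cvg; apply: nearW => n.
      by rewrite !(metric_sym q) !(metric_sym (y n)).
    apply: arithmetic_mean_cvg_ext (arithmetic_mean_cvgD _ _ _ _ _
      (arithmetic_mean_cvgD _ _ _ _ _ (cesaro c1)
        (arithmetic_mean_cvgN _ _ _ (cesaro c2)))
      (arithmetic_mean_cvg_shift _ _ 1 bphi)) => [n|]; last by lra.
    by rewrite /alpha /beta addn0 !addn1 (metric_sym (y n)); lra.
  - exists (fun n => 2 * mdist (x n.+1) (x n.+2) * mdist (y n) (y (n + k.+2)%N)).
      apply: cvgM => //; apply: cvgM; first exact: cvg_cst.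
      exact: (shiftS _ _ x1).
    move=> n; have := CAT0_quadrilateral _ _ (x n.+1) (x n.+2)
      (y (n + k.+2)%N) (y n) hX.
    rewrite /alpha /beta addn2 addn1 !addSn !addnS.
    rewrite !(metric_sym (y n)); lra.
have a10 : a 1%N = 0.
  apply/eqP; rewrite eq_le a_ge0 andbT leNgt; apply/negP => a1.
  (* This index exceeds [M / a 1], so linear growth would break the bound [M]. *)
  have := a_leM (Num.truncn (M / a 1%N)).+1; rewrite a_linear leNgt => /negP; apply.
  by rewrite -ltr_pdivrMr// truncnS_gt.
split; rewrite /asymptotically_regular.
- by rewrite a10 in x1.
- by have := ya 1%N; rewrite a10; under eq_fun do rewrite addn1.
Qed.
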